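(* Let $\langle W|$ be a row vector, $|V\rangle$ a column vector, and $D$ and $E$ matrices (not necessarily finite-dimensional) satisfying $$\langle W|V\rangle=1,\qquad \langle W|E=\langle W|,\qquad D|V\rangle=rE|V\rangle,\qquad DE=qED+E+D.$$ Then for every $n\ge 0$ the generating function $B_n(q,r)$ of type B permutation tableaux of length $n$, where $q$ counts the superfluous $1$'s and $r$ counts the $1$'s on the main diagonal, satisfies $$B_n(q,r)=\langle W|(D+E)^n|V\rangle .$$
   Context: A shifted Young diagram is a finite order ideal (down-set) of $\{(i,j)\in\mathbb{N}\times\mathbb{N}: i\le j\}$ (with $i,j\geq 1$) ordered by $(i,j)\ge(i',j')$ iff $i\ge i'$ and $j\ge j'$. The cell $(i,j)$ is drawn in row $i$ (rows numbered from top to bottom) and column $j$ (columns numbered from left to right); its shape $\lambda=(\lambda_1,\dots,\lambda_k)$ (a strictly decreasing, possibly empty, sequence of positive integers) lists the row lengths, so row $i$ consists of the cells $(i,j)$ with $i\le j\le i+\lambda_i-1$. The main diagonal consists of the cells $(i,i)$. A type B permutation tableau of length $n$ is a filling with $0$'s and $1$'s of a shifted Young diagram of shape $\lambda=(\lambda_1,\dots,\lambda_k)$ with $\lambda_1\le n$, such that: (i) any $0$ on the main diagonal has only $0$'s above it in its column; (ii) no $0$ has both a $1$ above it (in the same column) and a $1$ to its left (in the same row); (iii) each row contains at least one $1$. The empty diagram is allowed, and $n$ is part of the data (rightmost columns of length $0$ are allowed so that there are $n$ columns in total). A $1$ in a type B permutation tableau is superfluous if it is not the leftmost $1$ of its row.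 Thus $B_n(q,r)=\sum_T q^{s(T)}r^{d(T)}$, the sum being over all type B permutation tableaux $T$ of length $n$, with $s(T)$ the number of superfluous $1$'s and $d(T)$ the number of $1$'s on the main diagonal. $q,r$ are parameters (indeterminates). The vectors and matrices may be infinite; as usual, all products of them that are considered are assumed to be well defined and associative. *)

(* Defs.v *)
(* Plain MathComp. *)
From HB Require Import structures.
From mathcomp Require Import all_boot all_order all_algebra.

Set Implicit Arguments.
Unset Strict Implicit.
Unset Printing Implicit Defensive.

Import GRing.Theory.
Local Open Scope ring_scope.

(** * Type B permutation tableaux *)

(* Rows and columns are numbered from 0, so the cell in row i and column j of
   the text is (i-1, j-1) here and i <= j is unchanged.  Using the index set
   'I_n encodes the condition lambda_1 <= n: the diagram lies in the first n
   columns (and hence, as i <= j, in the first n rows). *)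
Definition cells (n : nat) := {set 'I_n * 'I_n}.

Section Tableaux.
Variable n : nat.
Implicit Types S F : cells n.

(* S is an order ideal of the pairs i <= j, for the componentwise order. *)
Definition shifted_diagram S : bool :=
  [forall c in S, c.1 <= c.2]%N &&
  [forall c in S, forall d : 'I_n * 'I_n,
     [&& d.1 <= d.2, d.1 <= c.1 & d.2 <= c.2]%N ==> (d \in S)].

(* A filling of S by 0's and 1's is given by the set F of the cells that
   contain a 1; the cells that contain a 0 are those of S :\: F. *)
Definition filling S F : bool := F \subset S.

Definition one_above F (i j : 'I_n) : bool :=
  [exists i' : 'I_n, (i' < i)%N && ((i', j) \in F)].

Definition one_to_the_left F (i j : 'I_n) : bool :=
  [exists j' : 'I_n, (j' < j)%N && ((i, j') \in F)].

Definition diagonal_condition S F : bool :=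
  [forall i : 'I_n, ((i, i) \in S :\: F) ==> ~~ one_above F i i].

Definition zero_condition S F : bool :=
  [forall c in S :\: F,
     ~~ (one_above F c.1 c.2 && one_to_the_left F c.1 c.2)].

Definition row_condition S F : bool :=
  [forall i : 'I_n,
     [exists j, (i, j) \in S] ==> [exists j, (i, j) \in F]].

Definition typeB_tableau S F : bool :=
  [&& shifted_diagram S, filling S F,
      diagonal_condition S F, zero_condition S F & row_condition S F].

Definition superfluous_ones F : nat :=
  #|[set c in F | one_to_the_left F c.1 c.2]|.

Definition diagonal_ones F : nat := #|[set c in F | c.1 == c.2]|.

End Tableaux.

Definition typeB_gf (n : nat) (K : comNzRingType) (q r : K) : K :=
  \sum_(T : cells n * cells n | typeB_tableau T.1 T.2)
     q ^+ superfluous_ones T.2 * r ^+ diagonal_ones T.2.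

(** * Possibly infinite matrices *)

(* The products of matrices indexed by a possibly infinite set I are
   (XY)_{ij} = sum_k X_{ik} Y_{kj}.  A summation is any linear way of assigning
   a sum to some families, extending the finite sums; this covers finite
   matrices, finitely supported sums, and convergent sums alike.  The value of
   total on families that are not summable is irrelevant. *)
Record summation (K : comNzRingType) (I : eqType) := Summation {
  summable : (I -> K) -> Prop;
  total : (I -> K) -> K;
  summable_lin : forall (a : K) (f g : I -> K),
    summable f -> summable g -> summable (fun i => a * f i + g i);
  total_lin : forall (a : K) (f g : I -> K),
    summable f -> summable g ->
    total (fun i => a * f i + g i) = a * total f + total g;
  summable_single : forall (i : I) (a : K),
    summable (fun k => if k == i then a else 0);
  total_single : forall (i : I) (a : K),
    total (fun k => if k == i then a else 0) = a
}.

Section Matrices.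
Variables (K : comNzRingType) (I : eqType) (sm : summation K I).

Definition infvec := I -> K.
Definition infmx := I -> I -> K.
Implicit Types (w v : infvec) (X Y Z : infmx).

Definition infdot w v : K := total sm (fun k => w k * v k).
Definition rowvec_mul w X : infvec := fun j => total sm (fun k => w k * X k j).
Definition mul_colvec X v : infvec := fun i => total sm (fun k => X i k * v k).
Definition infmx_mul X Y : infmx :=
  fun i j => total sm (fun k => X i k * Y k j).

Definition infdot_defined w v : Prop := summable sm (fun k => w k * v k).
Definition rowvec_mul_defined w X : Prop :=
  forall j, summable sm (fun k => w k * X k j).
Definition mul_colvec_defined X v : Prop :=
  forall i, summable sm (fun k => X i k * v k).
Definition infmx_mul_defined X Y : Prop :=
  forall i j, summable sm (fun k => X i k * Y k j).

Definition infmx_one : infmx := fun i j => if i == j then 1 else 0.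
Definition infmx_add X Y : infmx := fun i j => X i j + Y i j.
Definition infmx_exp X (n : nat) : infmx := iter n (infmx_mul X) infmx_one.

Inductive product_of (D E : infmx) : infmx -> Prop :=
| product_one : product_of D E infmx_one
| product_left : product_of D E D
| product_right : product_of D E E
| product_mul X Y :
    product_of D E X -> product_of D E Y -> product_of D E (infmx_mul X Y).

(* All the products formed from one W on the left, one V on the right and
   factors D and E in between are well defined and associative.  The same then
   holds for linear combinations of D and E, by linearity of the summation. *)
Record products_well_behaved (W : infvec) (D E : infmx) (V : infvec) : Prop := {
  infmx_mul_ok : forall X Y, product_of D E X -> product_of D E Y ->
    infmx_mul_defined X Y;
  rowvec_mul_ok : forall X Y, product_of D E X -> product_of D E Y ->
    rowvec_mul_defined (rowvec_mul W X) Y;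
  mul_colvec_ok : forall X Y, product_of D E X -> product_of D E Y ->
    mul_colvec_defined X (mul_colvec Y V);
  infdot_ok : forall X Y, product_of D E X -> product_of D E Y ->
    infdot_defined (rowvec_mul W X) (mul_colvec Y V);
  infmx_mul_assoc : forall X Y Z,
    product_of D E X -> product_of D E Y -> product_of D E Z ->
    infmx_mul X (infmx_mul Y Z) =2 infmx_mul (infmx_mul X Y) Z;
  rowvec_mul_assoc : forall X Y, product_of D E X -> product_of D E Y ->
    rowvec_mul (rowvec_mul W X) Y =1 rowvec_mul W (infmx_mul X Y);
  mul_colvec_assoc : forall X Y, product_of D E X -> product_of D E Y ->
    mul_colvec X (mul_colvec Y V) =1 mul_colvec (infmx_mul X Y) V;
  infdot_assoc : forall X Y Z,
    product_of D E X -> product_of D E Y -> product_of D E Z ->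
    infdot (rowvec_mul (rowvec_mul W X) Y) (mul_colvec Z V)
      = infdot (rowvec_mul W X) (mul_colvec Y (mul_colvec Z V))
}.

End Matrices.

(* Main.v *)
Require Import Defs.
From HB Require Import structures.
From mathcomp Require Import all_boot all_order all_algebra.
From Stdlib Require Import FunctionalExtensionality.

Set Implicit Arguments.
Unset Strict Implicit.
Unset Printing Implicit Defensive.

Import GRing.Theory.
Local Open Scope ring_scope.

(** Expand <W|(D+E)^n|V> into the numbers F(w) = <W|w|V>, with w a word of
length n in D and E.  The hypotheses become the rules F(Ew) = F(w),
F(wD) = r F(wE) and F(w DE w') = q F(w ED w') + F(w E w') + F(w D w'), and only
these rules are used to compare with tableaux.

On the tableau side, call a column free if it has no 0 that lies on the
diagonal or has a 1 to its left; such a 0 forces 0's above itself, and nothing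
else in the tableau constrains a new row on top.  A tableau of length n+1 arises
from a unique tableau T of length n either by adding an empty column on the
right, which creates one more free column, or by adding a top row of full length
n+1.  The new row has 1's in any nonempty subset A of the free columns of T and
the new first column.  Its effect on the weights and on the number u of free
columns depends on T only through u, and removing the last free column gives
a recursion in u for the sum over all A (sum_top_rows): a function f of the
number of free columns is replaced by row_sum u f.  Hence the sum of
q^s(T) r^d(T) f(u(T)) over tableaux of length n+1 is the sum of
q^s(T) r^d(T) (f(u(T)+1) + row_sum u(T) f) over tableaux of length n
(tableau_sumS).

The three rules for F say that reading words from the right obeys the same
recursion: pushing D through a block E^u by the third rule until the second one
applies yields F(w D E^u) = row_sum u (v |-> F(w E^v)) (row_sum_word).  So u free
columns play the part of the vector E^u|V>, an empty column that of the operator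
E, and a full top row that of the operator D.  At the end, F(E^u) = 1 turns the
refined sum into B_n(q,r) (typeB_gf_words). *)

(** * Words in D and E *)

(** With f(v) standing for E^v|V>, this is the expansion of D E^u|V>: the step
from u to u+1 is D E = q E D + E + D applied to E^u|V>, where the left factor E
shifts f. *)
Fixpoint row_sum (K : comNzRingType) (q r : K) (u : nat) (f : nat -> K) : K :=
  if u is u'.+1 then
    row_sum q r u' f + q * row_sum q r u' (f \o succn) + f u
  else r * f 1%N.

Lemma eq_row_sum (K : comNzRingType) (q r : K) (u : nat) (f g : nat -> K) :
  f =1 g -> row_sum q r u f = row_sum q r u g.
Proof.
elim: u f g => [|u IHu] f g fg /=; first by rewrite fg.
by rewrite (IHu f g fg) (IHu (f \o succn) (g \o succn)) ?fg // => v /=.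
Qed.

Lemma row_sum_sum (K : comNzRingType) (q r : K) (u : nat) (T : Type)
    (s : seq T) (f : T -> nat -> K) :
  row_sum q r u (fun v => \sum_(t <- s) f t v) = \sum_(t <- s) row_sum q r u (f t).
Proof.
elim: u f => [|u IHu] f /=; first by rewrite mulr_sumr.
rewrite IHu (eq_row_sum _ _ _ (g := fun v => \sum_(t <- s) (f t \o succn) v)) //.
by rewrite IHu mulr_sumr -!big_split.
Qed.

(** The letter D is encoded by true and E by false. *)
Fixpoint words (n : nat) : seq (seq bool) :=
  if n is n'.+1 then
    map (cons true) (words n') ++ map (cons false) (words n')
  else [:: [::]].

Lemma sum_words_cons (K : nmodType) (F : seq bool -> K) (n : nat) :
  \sum_(w <- words n.+1) F w =
    \sum_(w <- words n) (F (true :: w) + F (false :: w)).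
Proof. by rewrite big_cat !big_map big_split. Qed.

Lemma sum_words_rcons (K : nmodType) (F : seq bool -> K) (n : nat) :
  \sum_(w <- words n.+1) F w =
    \sum_(w <- words n) (F (rcons w true) + F (rcons w false)).
Proof.
elim: n F => [|n IHn] F; first by rewrite sum_words_cons !big_seq1.
rewrite sum_words_cons big_split /=.
rewrite (IHn (fun w => F (true :: w))) (IHn (fun w => F (false :: w))).
by rewrite -big_split sum_words_cons; apply: eq_bigr.
Qed.

Section WordRelations.
Variables (K : comNzRingType) (q r : K) (F : seq bool -> K).
Hypothesis F_headE : forall w, F (false :: w) = F w.
Hypothesis F_lastD : forall w, F (rcons w true) = r * F (rcons w false).
Hypothesis F_DE : forall w w',
  F (w ++ true :: false :: w') =
    q * F (w ++ false :: true :: w') + F (w ++ false :: w') + F (w ++ true :: w').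

(** The induction is over u for all prefixes w at once, since the term
q E D E^u moves one letter E into the prefix. *)
Lemma row_sum_word (u : nat) (w : seq bool) :
  F (w ++ true :: nseq u false) = row_sum q r u (fun v => F (w ++ nseq v false)).
Proof.
elim: u w => [|u IHu] w /=; first by rewrite !cats1 F_lastD.
rewrite F_DE addrAC addrC [_ * _ + _]addrC addrA [RHS]addrC addrA.
congr (_ + _ + _) => //.
congr (_ * _); rewrite -cat_rcons IHu; apply: eq_row_sum => v /=.
by rewrite cat_rcons.
Qed.

(** The last letter of the word of length n+1 is absorbed into the block E^u:
a letter E lengthens it, and a letter D is pushed through it. *)
Lemma sum_words_step (n u : nat) :
  \sum_(w <- words n.+1) F (w ++ nseq u false) =
    \sum_(w <- words n) F (w ++ nseq u.+1 false)
    + row_sum q r u (fun v => \sum_(w <- words n) F (w ++ nseq v false)).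
Proof.
rewrite (sum_words_rcons (fun w => F (w ++ nseq u false))) big_split [RHS]addrC /=.
congr (_ + _); last by apply: eq_bigr => w _; rewrite cat_rcons.
by rewrite row_sum_sum; apply: eq_bigr => w _; rewrite cat_rcons row_sum_word.
Qed.

Lemma word_nseqE (u : nat) : F (nseq u false) = F [::].
Proof. by elim: u => //= u <-. Qed.

End WordRelations.

(** * The choices for a full top row *)

Lemma big_subset_setU1 (R : nmodType) (T : finType) (z : T) (B : {set T})
    (f : {set T} -> R) : z \notin B ->
  \sum_(A : {set T} | A \subset z |: B) f A =
    \sum_(A : {set T} | A \subset B) (f A + f (z |: A)).
Proof.
move=> zB; rewrite big_split (bigID (fun A : {set T} => z \notin A)) /=.
congr (_ + _); first by apply: eq_bigl => A; rewrite -subsetD1 setU1K.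
rewrite (reindex_onto (fun A => z |: A) (fun A => A :\ z)) /=; last first.
  by move=> A; rewrite negbK => /andP[_ /setD1K].
apply: eq_bigl => A; rewrite setU11 !andbT.
apply/andP/idP => [[sA /eqP eA]|sA].
  by rewrite -eA subDset.
have zA : z \notin A by apply: contra zB; apply: (subsetP sA).
by rewrite setUS // setU1K.
Qed.

Section TopRow.
Variable n : nat.
Implicit Types (U : {set 'I_n.+1}).

(** U is the set of columns that were free before the row was added, and A the
set of 1's in the new top row.  A 0 of the new row makes its column non-free if
it lies on the diagonal (column ord0) or has a 1 to its left. *)
Definition kept_cols (A : {set 'I_n.+1}) U : {set 'I_n.+1} :=
  [set j in ord0 |: U | (j \in A) ||
     ((j != ord0) && [forall k : 'I_n.+1, (k < j)%N ==> (k \notin A)])].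

(** Induction on the size of U, removing its largest element z.  If the rest of
A is nonempty, a 0 in column z has a 1 to its left and z stops being free, while
a 1 in column z is superfluous (factor q) and z stays free.  If A = {z}, its 1
is not superfluous, and all of U stays free while the first column is not. *)
Lemma sum_top_rows (K : comNzRingType) (q r : K) (f : nat -> K) U :
  ord0 \notin U ->
  \sum_(A : {set 'I_n.+1} | (A \subset ord0 |: U) && (A != set0))
     q ^+ #|A|.-1 * r ^+ (ord0 \in A) * f #|kept_cols A U| =
  row_sum q r #|U| f.
Proof.
move: {2}(#|U|) (erefl #|U|) => u; elim: u U f => [|u IHu] U f cU U0.
  have -> : U = set0 by apply/eqP; rewrite -cards_eq0 cU.
  rewrite setU0 cards0 /= (big_pred1 [set ord0]) => [|A].
    rewrite cards1 set11 expr0 expr1 mul1r.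
    suff -> : kept_cols [set ord0] set0 = [set ord0] by rewrite cards1.
    by apply/setP => j; rewrite !inE orbF; case: (j == ord0).
  rewrite subset1 /=; have [->|_] := eqVneq A [set ord0].
    by apply/set0Pn; exists ord0; rewrite set11.
  by rewrite andbN.
have [z zU zmax] : exists2 z, z \in U & forall j, j \in U -> (j <= z)%N.
  have /card_gt0P[z0 z0U] : (0 < #|U|)%N by rewrite cU.
  case: (@arg_maxnP _ z0 (mem U) (@nat_of_ord _) z0U) => z zU zm.
  by exists z.
have z0 : z != ord0 by apply: contraNneq U0 => <-.
set U' := U :\ z.
have UE : U = z |: U' by rewrite setD1K.
have zU' : z \notin ord0 |: U' by rewrite !inE eqxx (negPf z0).
have cU' : #|U'| = u by move: cU; rewrite UE cardsU1 !inE eqxx /= => -[].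
have U'0 : ord0 \notin U' by rewrite !inE (negPf U0) andbF.
have ltz j : j \in ord0 |: U' -> (j < z)%N.
  rewrite !inE => /orP[/eqP->|/andP[jz jU]]; first by rewrite lt0n.
  by rewrite ltn_neqAle jz zmax.
have BE : ord0 |: U = z |: (ord0 |: U') by rewrite UE setUCA.
rewrite big_mkcondr /= BE big_subset_setU1 // big_split /= -big_mkcondr /=.
rewrite cU /= -cU' -!IHu //.
have keptN (A : {set 'I_n.+1}) : A \subset ord0 |: U' -> A != set0 ->
    kept_cols A U = kept_cols A U'.
  move=> sA /set0Pn[a aA]; apply/setP => j; rewrite !inE.
  have [->|//] := eqVneq j z.
  have -> : (z \in A) = false by apply: contraNF zU'; apply: (subsetP sA).
  rewrite (negPf z0) /=; case: forallP => [/(_ a)|_]; last by rewrite !andbF.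
  by rewrite aA implybF ltz ?(subsetP sA).
have keptI (A : {set 'I_n.+1}) : A \subset ord0 |: U' -> 
    kept_cols (z |: A) U = z |: kept_cols A U'.
  move=> sA; apply/setP => j; rewrite !inE.
  have [->|jz] := eqVneq j z; first by rewrite zU orbT.
  rewrite /=; apply: andb_id2l => jB; congr (_ || (_ && _)).
  apply: eq_forallb => k; apply: implyb_id2l => kj; rewrite !inE.
  suff -> : (k == z) = false by [].
  have jB' : j \in ord0 |: U' by rewrite !inE jz.
  by apply: contraTF kj => /eqP->; rewrite -leqNgt ltnW ?ltz.
have zk (A : {set 'I_n.+1}) : z \notin kept_cols A U'.
  by rewrite inE (negPf zU').
rewrite -addrA; congr (_ + _).
  by apply: eq_bigr => A /andP[sA An]; rewrite keptN.
have nz A : z |: A != set0 by apply/set0Pn; exists z; rewrite setU11.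
under eq_bigr => A _ do rewrite nz.
(* The subset set0 of ord0 |: U' is the case A = {z}. *)
rewrite (bigD1 set0) ?sub0set //= addrC; congr (_ + _).
  rewrite mulr_sumr; apply: eq_bigr => A /andP[sA An].
  have zA : z \notin A by apply: contra zU'; apply: (subsetP sA).
  rewrite keptI // !cardsU1 zk zA !inE eq_sym (negPf z0) /= !add1n.
  by rewrite !mulrA -exprS prednK ?card_gt0.
have -> : kept_cols (z |: set0) U = U.
  rewrite keptI ?sub0set // UE; congr (_ |: _).
  apply/setP => j; rewrite !inE /=.
  have -> : [forall k : 'I_n.+1, (k < j)%N ==> (k \notin set0)].
    by apply/forallP => k; rewrite inE implybT.
  by rewrite andbT; have [->|_] := eqVneq j ord0; rewrite ?(negPf U0) ?andbF ?andbT.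
by rewrite setU0 cards1 !inE eq_sym (negPf z0) /= !mul1r cU cU'.
Qed.
End TopRow.

(** * Free columns of a tableau *)

(** In a tableau such a 0 has only 0's above it. *)
Definition restricting (n : nat) (S F : cells n) (i j : 'I_n) : bool :=
  [&& (i, j) \in S, (i, j) \notin F & (i == j) || one_to_the_left F i j].

Definition free_cols (n : nat) (S F : cells n) : {set 'I_n} :=
  [set j | [forall i, ~~ restricting S F i j]].

(** The diagonal condition and the zero condition both forbid a 1 above certain
0's, so they merge into one condition on restricting cells. *)
Lemma typeB_tableauP (n : nat) (S F : cells n) :
  reflect [/\ forall i j, (i, j) \in S -> (i <= j)%N,
              forall i j i' j' : 'I_n, (i, j) \in S ->
                (i' <= j')%N -> (i' <= i)%N -> (j' <= j)%N -> (i', j') \in S,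
              F \subset S,
              forall i i' j : 'I_n, (i' < i)%N -> restricting S F i j ->
                (i', j) \notin F
            & forall i j, (i, j) \in S -> exists j', (i, j') \in F]
          (typeB_tableau S F).
Proof.
apply: (iffP and5P) => [[/andP[/forall_inP le_S /forall_inP ideal_S] FS
    /forallP diagF /forall_inP zeroF /forallP rowF]
  | [le_S ideal_S FS restrF rowF]].
- split=> //.
  + by move=> i j /le_S.
  + move=> i j i' j' /ideal_S/forallP/(_ (i', j'))/implyP /= ideal le1 le2 le3.
    by apply: ideal; rewrite le1 le2.
  + move=> i i' j lti /and3P[ijS ijF /orP[/eqP ij|left_ij]].
      subst j; have /implyP := diagF i; rewrite inE ijF ijS => /(_ isT).
      by apply: contra => i'F; apply/existsP; exists i'; rewrite lti.
    have /zeroF := introT setDP (conj ijS ijF).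
    rewrite /= left_ij andbT; apply: contra => i'F.
    by apply/existsP; exists i'; rewrite lti.
  + move=> i j ijS; have /implyP/(_ _)/existsP := rowF i; apply.
    by apply/existsP; exists j.
- split=> //.
  + apply/andP; split; apply/forall_inP => -[i j] /=; first exact: le_S.
    move=> ijS; apply/forallP => -[i' j'] /=; apply/implyP => /and3P[*].
    exact: ideal_S ijS _ _ _.
  + apply/forallP => i; apply/implyP => /setDP[iS iF].
    apply/existsPn => i'; rewrite negb_and -implybE; apply/implyP => lti.
    by apply: restrF lti _; apply/and3P; rewrite eqxx.
  + apply/forall_inP => -[i j] /setDP[ijS ijF] /=; rewrite andbC negb_and.
    rewrite -implybE; apply/implyP => left_ij.
    apply/existsPn => i'; rewrite negb_and -implybE; apply/implyP => lti.
    by apply: restrF lti _; apply/and3P; rewrite left_ij orbT.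
  + apply/forallP => i; apply/implyP => /existsP[j /rowF[j' F']].
    by apply/existsP; exists j'.
Qed.

Lemma card_pairs (T1 T2 : finType) (P : pred (T1 * T2)) :
  #|[set c | P c]| = (\sum_i \sum_j P (i, j))%N.
Proof.
rewrite cardsE -sum1_card big_mkcond pair_bigA /=.
by apply: eq_bigr => -[i j] _ /=; rewrite unfold_in; case: (P _).
Qed.

Lemma superfluousE (n : nat) (F : cells n) :
  superfluous_ones F =
  (\sum_i \sum_j (((i, j) \in F) && one_to_the_left F i j))%N.
Proof. exact: card_pairs. Qed.

Lemma diagonalE (n : nat) (F : cells n) :
  diagonal_ones F = (\sum_i ((i, i) \in F))%N.
Proof.
rewrite /diagonal_ones card_pairs; apply: eq_bigr => i _ /=.
rewrite (bigD1 i) //= eqxx andbT big1 ?addn0 // => j.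
by rewrite eq_sym => /negPf->; rewrite andbF.
Qed.

(** * Adding an empty column on the right *)

Section AddColumn.
Variable n : nat.
Implicit Types (S F : cells n).

(** The index ord_max gets an empty row as well as an empty column, because
the rows of a diagram of length n are also indexed by 'I_n. *)
Definition add_column S : cells n.+1 :=
  [set c | match unlift ord_max c.1, unlift ord_max c.2 with
           | Some i, Some j => (i, j) \in S
           | _, _ => false end].

Definition remove_column (S : cells n.+1) : cells n :=
  [set c | (lift ord_max c.1, lift ord_max c.2) \in S].

Lemma in_add_column S i j :
  ((lift ord_max i, lift ord_max j) \in add_column S) = ((i, j) \in S).
Proof. by rewrite inE /= !liftK. Qed.

Lemma add_column_maxr S i : ((i, ord_max) \in add_column S) = false.
Proof. by rewrite inE /= unlift_none; case: unlift. Qed.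

Lemma add_column_maxl S j : ((ord_max, j) \in add_column S) = false.
Proof. by rewrite inE /= unlift_none. Qed.

Lemma add_columnK : cancel add_column remove_column.
Proof. by move=> S; apply/setP => -[i j]; rewrite inE in_add_column. Qed.

Variant ord_max_spec : 'I_n.+1 -> Type :=
| OrdMax : ord_max_spec ord_max
| OrdLiftMax i : ord_max_spec (lift ord_max i).

Lemma ord_maxP i : ord_max_spec i.
Proof. by case: (unliftP ord_max i) => [j|] ->; constructor. Qed.

Lemma one_left_add_column F i j :
  one_to_the_left (add_column F) (lift ord_max i) (lift ord_max j) =
  one_to_the_left F i j.
Proof.
apply/existsP/existsP => -[j']; last first.
  by exists (lift ord_max j'); rewrite in_add_column !lift_max.
case: (ord_maxP j') => [|{}j']; first by rewrite add_column_maxr andbF.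
by rewrite in_add_column !lift_max; exists j'.
Qed.

Lemma restricting_add_column S F i j :
  restricting (add_column S) (add_column F) (lift ord_max i) (lift ord_max j) =
  restricting S F i j.
Proof.
by rewrite /restricting !in_add_column one_left_add_column (inj_eq lift_inj).
Qed.

Lemma typeB_add_column S F :
  typeB_tableau (add_column S) (add_column F) = typeB_tableau S F.
Proof.
apply/typeB_tableauP/typeB_tableauP => -[le_S ideal_S FS restrF rowF]; split.
- move=> i j; rewrite -in_add_column => /le_S; by rewrite !lift_max.
- move=> i j i' j'; rewrite -!in_add_column => ijS l1 l2 l3.
  by apply: ideal_S ijS _ _ _; rewrite !lift_max.
- apply/subsetP => -[i j]; rewrite -!in_add_column; exact: subsetP.
- move=> i i' j lti; rewrite -restricting_add_column -in_add_column.
  by apply: restrF; rewrite !lift_max.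
- move=> i j; rewrite -in_add_column => /rowF[j'].
  case: (ord_maxP j') => [|{}j']; first by rewrite add_column_maxr.
  by rewrite in_add_column; exists j'.
- move=> i j; case: (ord_maxP i) => [|{}i]; first by rewrite add_column_maxl.
  case: (ord_maxP j) => [|{}j]; first by rewrite add_column_maxr.
  by rewrite in_add_column !lift_max => /le_S.
- move=> i j i' j'; case: (ord_maxP i) => [|{}i]; first by rewrite add_column_maxl.
  case: (ord_maxP j) => [|{}j]; first by rewrite add_column_maxr.
  rewrite in_add_column => ijS.
  case: (ord_maxP j') => [|{}j'].
    by move=> _ _; rewrite lift_max leqNgt ltn_ord.
  case: (ord_maxP i') => [|{}i'].
    by rewrite lift_max leqNgt ltn_ord.
  rewrite !lift_max in_add_column; exact: ideal_S.
- apply/subsetP => -[i j]; case: (ord_maxP i) => [|{}i]; first by rewrite add_column_maxl.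
  case: (ord_maxP j) => [|{}j]; first by rewrite add_column_maxr.
  rewrite !in_add_column; exact: subsetP.
- move=> i i' j; case: (ord_maxP i') => [|{}i']; first by rewrite add_column_maxl.
  case: (ord_maxP j) => [|{}j]; first by rewrite add_column_maxr.
  case: (ord_maxP i) => [|{}i]; first by rewrite /restricting add_column_maxl.
  rewrite !lift_max restricting_add_column in_add_column; exact: restrF.
- move=> i j; case: (ord_maxP i) => [|{}i]; first by rewrite add_column_maxl.
  case: (ord_maxP j) => [|{}j]; first by rewrite add_column_maxr.
  rewrite in_add_column => /rowF[j' ij'F].
  by exists (lift ord_max j'); rewrite in_add_column.
Qed.

(** When the top row misses the last column, that column is empty because the
diagram is an order ideal, and so is the last row, whose only possible cell lies
in that column. *)
Lemma remove_columnK (S F : cells n.+1) :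
  typeB_tableau S F -> (ord0, ord_max) \notin S ->
  add_column (remove_column S) = S /\ add_column (remove_column F) = F.
Proof.
case/typeB_tableauP => le_S ideal_S FS _ _ S0.
have Smaxr i : (i, ord_max) \notin S.
  by apply: contra S0 => /ideal_S; apply.
have Smaxl j : (ord_max, j) \notin S.
  apply/negP => jS; suff jE : j = ord_max.
    by case/negP: (Smaxr ord_max); rewrite -{2}jE.
  by apply/val_inj/anti_leq; rewrite (le_S _ _ jS) -ltnS ltn_ord.
have aux (G : cells n.+1) : G \subset S -> add_column (remove_column G) = G.
  move=> GS; apply/setP => -[i j].
  case: (ord_maxP i) => [|{}i].
    by rewrite add_column_maxl; symmetry; apply: contraNF (Smaxl j); apply: (subsetP GS).
  case: (ord_maxP j) => [|{}j].
    rewrite add_column_maxr; symmetry.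
    by apply: contraNF (Smaxr (lift ord_max i)); apply: (subsetP GS).
  by rewrite in_add_column inE.
by split; apply: aux.
Qed.

Lemma superfluous_add_column F :
  superfluous_ones (add_column F) = superfluous_ones F.
Proof.
rewrite !superfluousE big_ord_recr /= [X in (_ + X)%N]big1 => [|j _]; last first.
  by rewrite add_column_maxl.
rewrite addn0; apply: eq_bigr => i _; rewrite big_ord_recr /= add_column_maxr addn0.
apply: eq_bigr => j _.
have wE k : widen_ord (leqnSn n) k = lift ord_max k.
  by apply: ord_inj; rewrite lift_max.
by rewrite !wE in_add_column one_left_add_column.
Qed.

Lemma diagonal_add_column F : diagonal_ones (add_column F) = diagonal_ones F.
Proof.
rewrite !diagonalE big_ord_recr /= add_column_maxl addn0; apply: eq_bigr => i _.
have -> : widen_ord (leqnSn n) i = lift ord_max i.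
  by apply: ord_inj; rewrite lift_max.
by rewrite in_add_column.
Qed.

Lemma free_add_column S F :
  #|free_cols (add_column S) (add_column F)| = #|free_cols S F|.+1.
Proof.
have -> : free_cols (add_column S) (add_column F) =
    ord_max |: [set lift ord_max j | j in free_cols S F].
  apply/setP => j; rewrite !inE; case: (ord_maxP j) => [|{}j].
    rewrite eqxx; apply/forallP => i.
    by rewrite /restricting add_column_maxr.
  rewrite eq_sym (negPf (neq_lift _ _)) (mem_imset _ _ lift_inj) inE.
  apply/forallP/forallP => rS i; first by rewrite -restricting_add_column.
  case: (ord_maxP i) => [|{}i]; first by rewrite /restricting add_column_maxl.
  by rewrite restricting_add_column.
rewrite cardsU1 card_imset; last exact: lift_inj.
by case: imsetP => // -[j _ /eqP]; rewrite (negPf (neq_lift _ _)).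
Qed.

End AddColumn.

(** * Adding a full top row *)

Section AddRow.
Variable n : nat.
Implicit Types (S F : cells n) (A : {set 'I_n.+1}).

(** The old diagram moves one step down and one step right, so that its diagonal
stays on the diagonal.  Used with A = setT for the diagram and with A the set of
1's of the new row for the filling. *)
Definition add_row A S : cells n.+1 :=
  [set c | match unlift ord0 c.1, unlift ord0 c.2 with
           | None, _ => c.2 \in A
           | Some i, Some j => (i, j) \in S
           | Some _, None => false end].

Definition remove_row (S : cells n.+1) : cells n :=
  [set c | (lift ord0 c.1, lift ord0 c.2) \in S].

Definition top_row (S : cells n.+1) : {set 'I_n.+1} :=
  [set j | (ord0, j) \in S].

Lemma in_add_row A S i j :
  ((lift ord0 i, lift ord0 j) \in add_row A S) = ((i, j) \in S).
Proof. by rewrite inE /= !liftK. Qed.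

Lemma add_row_top A S j : ((ord0, j) \in add_row A S) = (j \in A).
Proof. by rewrite inE /= unlift_none. Qed.

Lemma add_row_first A S i : ((lift ord0 i, ord0) \in add_row A S) = false.
Proof. by rewrite inE /= unlift_none liftK. Qed.

Lemma add_rowK A : cancel (add_row A) remove_row.
Proof. by move=> S; apply/setP => -[i j]; rewrite inE in_add_row. Qed.

Lemma top_add_row A S : top_row (add_row A S) = A.
Proof. by apply/setP => j; rewrite inE add_row_top. Qed.

Variant ord0_spec : 'I_n.+1 -> Type :=
| Ord0 : ord0_spec ord0
| OrdLift0 i : ord0_spec (lift ord0 i).

Lemma ord0P i : ord0_spec i.
Proof. by case: (unliftP ord0 i) => [j|] ->; constructor. Qed.

Lemma one_left_add_row A F i j :
  one_to_the_left (add_row A F) (lift ord0 i) (lift ord0 j) =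
  one_to_the_left F i j.
Proof.
apply/existsP/existsP => -[j']; last first.
  by exists (lift ord0 j'); rewrite in_add_row !lift0 ltnS.
case: (ord0P j') => [|{}j']; first by rewrite add_row_first andbF.
by rewrite in_add_row !lift0 ltnS; exists j'.
Qed.

Lemma one_left_top A F j :
  one_to_the_left (add_row A F) ord0 j =
  ~~ [forall k : 'I_n.+1, (k < j)%N ==> (k \notin A)].
Proof.
rewrite negb_forall; apply: eq_existsb => k.
by rewrite add_row_top negb_imply negbK.
Qed.

Lemma restricting_add_row A S F i j :
  restricting (add_row setT S) (add_row A F) (lift ord0 i) (lift ord0 j) =
  restricting S F i j.
Proof.
by rewrite /restricting !in_add_row one_left_add_row (inj_eq lift_inj).
Qed.

Lemma restricting_first A S F i :
  restricting (add_row setT S) (add_row A F) (lift ord0 i) ord0 = false.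
Proof. by rewrite /restricting add_row_first. Qed.

Lemma typeB_add_row A S F :
  typeB_tableau (add_row setT S) (add_row A F) =
  typeB_tableau S F &&
    ((A \subset ord0 |: [set lift ord0 j | j in free_cols S F]) && (A != set0)).
Proof.
apply/typeB_tableauP/and3P => [[le_S ideal_S FS restrF rowF]
  | [/typeB_tableauP[le_S ideal_S FS restrF rowF] AS A0]]; split.
- apply/typeB_tableauP; split.
  + by move=> i j; rewrite -(in_add_row setT) => /le_S; rewrite !lift0.
  + move=> i j i' j'; rewrite -!(in_add_row setT) => ijS l1 l2 l3.
    by apply: ideal_S ijS _ _ _; rewrite !lift0.
  + apply/subsetP => -[i j]; rewrite -(in_add_row A) -(in_add_row setT).
    exact: subsetP.
  + move=> i i' j lti; rewrite -(restricting_add_row A) -(in_add_row A).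
    by apply: restrF; rewrite !lift0.
  + move=> i j; rewrite -(in_add_row setT) => /rowF[j'].
    case: (ord0P j') => [|{}j']; first by rewrite add_row_first.
    by rewrite in_add_row; exists j'.
- apply/subsetP => j; rewrite !inE; case: (ord0P j) => [//|{}j] jA.
  rewrite (mem_imset _ _ lift_inj) inE; apply/forallP => i.
  rewrite -(restricting_add_row A); apply/negP => rij.
  by have := restrF _ ord0 _ _ rij; rewrite add_row_top jA lift0 => /(_ isT).
- have [|j] := rowF ord0 ord0; first by rewrite add_row_top inE.
  by rewrite add_row_top => jA; apply/set0Pn; exists j.
- move=> i j; case: (ord0P i) => [//|{}i].
  case: (ord0P j) => [|{}j]; first by rewrite add_row_first.
  by rewrite in_add_row !lift0 ltnS => /le_S.
- move=> i j i' j'; case: (ord0P i') => [|{}i']; first by rewrite add_row_top inE.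
  case: (ord0P i) => [//|{}i].
  case: (ord0P j) => [|{}j]; first by rewrite add_row_first.
  case: (ord0P j') => [//|{}j'].
  rewrite !in_add_row !lift0 !ltnS; exact: ideal_S.
- apply/subsetP => -[i j]; case: (ord0P i) => [|{}i]; first by rewrite !add_row_top inE.
  case: (ord0P j) => [|{}j]; first by rewrite add_row_first.
  rewrite !in_add_row; exact: subsetP.
- move=> i i' j; case: (ord0P i) => [//|{}i].
  case: (ord0P j) => [|{}j]; first by rewrite restricting_first.
  case: (ord0P i') => [_|{}i'].
    rewrite restricting_add_row add_row_top => rij.
    apply/negP => /(subsetP AS); rewrite !inE eq_sym (negPf (neq_lift _ _)) /=.
    by rewrite (mem_imset _ _ lift_inj) inE => /forallP/(_ i); rewrite rij.
  rewrite !lift0 ltnS restricting_add_row in_add_row; exact: restrF.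
- move=> i j; case: (ord0P i) => [_|{}i].
    by have [k kA] := set0Pn _ A0; exists k; rewrite add_row_top.
  case: (ord0P j) => [|{}j]; first by rewrite add_row_first.
  rewrite in_add_row => /rowF[j' ij'F].
  by exists (lift ord0 j'); rewrite in_add_row.
Qed.

Lemma remove_rowK (S F : cells n.+1) :
  typeB_tableau S F -> (ord0, ord_max) \in S ->
  add_row setT (remove_row S) = S /\ add_row (top_row F) (remove_row F) = F.
Proof.
case/typeB_tableauP => le_S ideal_S FS _ _ S0.
have Sfirst i : (lift ord0 i, ord0) \notin S.
  by apply/negP => /le_S; rewrite lift0.
split; apply/setP => -[i j]; case: (ord0P i) => [|{}i].
- rewrite add_row_top inE; symmetry; apply: ideal_S S0 _ _ _ => //.
  by rewrite -ltnS ltn_ord.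
- case: (ord0P j) => [|{}j]; last by rewrite in_add_row inE.
  by rewrite add_row_first (negPf (Sfirst i)).
- by rewrite add_row_top inE.
- case: (ord0P j) => [|{}j]; last by rewrite in_add_row inE.
  by rewrite add_row_first; symmetry; apply: contraNF (Sfirst i); apply: (subsetP FS).
Qed.

(** All the 1's of the new row but its leftmost one are superfluous. *)
Lemma superfluous_add_row A F : A != set0 ->
  superfluous_ones (add_row A F) = (#|A|.-1 + superfluous_ones F)%N.
Proof.
move=> A0; rewrite !superfluousE big_ord_recl; congr (_ + _)%N; last first.
  apply: eq_bigr => i _; rewrite big_ord_recl add_row_first add0n.
  by apply: eq_bigr => j _; rewrite in_add_row one_left_add_row.
have [a0 a0A] := set0Pn _ A0.
(* a is the leftmost 1 of the new row. *)
have [a aA amin] : exists2 a, a \in A & forall j, j \in A -> (a <= j)%N.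
  case: (@arg_minnP _ a0 (mem A) (@nat_of_ord _) a0A) => a aA amin.
  by exists a.
rewrite (cardsD1 a A) aA add1n /= -sum1_card [RHS]big_mkcond /=.
apply: eq_bigr => j _.
rewrite add_row_top one_left_top !inE.
have [->|ja] := eqVneq j a.
  rewrite (_ : [forall k, _]) ?andbF //; apply/forallP => k; apply/implyP => ka.
  by apply/negP => /amin; rewrite leqNgt ka.
case jA: (j \in A) => //=; rewrite (_ : [forall k, _] = false) //.
apply/negP => /forallP/(_ a); rewrite aA implybF -leqNgt => lja.
by case/eqP: ja; apply/val_inj/anti_leq; rewrite lja; apply: amin.
Qed.

Lemma diagonal_add_row A F :
  diagonal_ones (add_row A F) = ((ord0 \in A) + diagonal_ones F)%N.
Proof.
rewrite !diagonalE big_ord_recl add_row_top; congr (_ + _)%N.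
by apply: eq_bigr => i _; rewrite in_add_row.
Qed.

Lemma free_add_row A S F :
  A \subset ord0 |: [set lift ord0 j | j in free_cols S F] ->
  free_cols (add_row setT S) (add_row A F) =
    kept_cols A [set lift ord0 j | j in free_cols S F].
Proof.
move=> AS; apply/setP => j; rewrite !inE.
have topE : restricting (add_row setT S) (add_row A F) ord0 j =
    ~~ ((j \in A) || (j != ord0) && [forall k : 'I_n.+1, (k < j)%N ==> (k \notin A)]).
  rewrite /restricting !add_row_top inE one_left_top negb_or negb_and negbK.
  by rewrite eq_sym.
case: (ord0P j) topE => [|{}j] topE.
  rewrite eqxx /= -[RHS]negbK -topE; apply/forallP/idP => // rS i.
  by case: (ord0P i) => // {}i; rewrite restricting_first.
rewrite (mem_imset _ _ lift_inj) inE -[X in _ && X]negbK -topE.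
rewrite eq_sym (negPf (neq_lift _ _)) /=.
apply/forallP/andP => [rS|[/forallP rS r0] i].
  by split=> //; apply/forallP => i; rewrite -(restricting_add_row A).
by case: (ord0P i) => // {}i; rewrite restricting_add_row.
Qed.

End AddRow.

(** * The recursion for tableaux *)

(** Refines typeB_gf, the case f = 1, by the number of free columns; a functional
of f takes the place of a generating function in a further variable. *)
Definition tableau_sum (K : comNzRingType) (q r : K) (n : nat) (f : nat -> K) : K :=
  \sum_(T : cells n * cells n | typeB_tableau T.1 T.2)
    q ^+ superfluous_ones T.2 * r ^+ diagonal_ones T.2
      * f #|free_cols T.1 T.2|.

Lemma eq_tableau_sum (K : comNzRingType) (q r : K) (n : nat) (f g : nat -> K) :
  f =1 g -> tableau_sum q r n f = tableau_sum q r n g.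
Proof. by move=> fg; apply: eq_bigr => T _; rewrite fg. Qed.

Lemma tableau_sum0 (K : comNzRingType) (q r : K) (f : nat -> K) :
  tableau_sum q r 0 f = f 0%N.
Proof.
have no_cells (X : cells 0) : X = set0 by apply/setP => -[[]].
rewrite /tableau_sum (big_pred1 (set0, set0)) => [|[S F]] /=; last first.
  rewrite (no_cells S) (no_cells F) eqxx; apply/typeB_tableauP.
  by split=> [[]|[]||[]|[]] //; rewrite sub0set.
rewrite superfluousE diagonalE !big_ord0 !expr0 !mul1r.
by congr f; apply/eqP; rewrite cards_eq0; apply/eqP/setP => -[].
Qed.

(** Whether the corner (ord0, ord_max) belongs to the diagram tells an empty last
column from a full top row. *)
Lemma tableau_sumS (K : comNzRingType) (q r : K) (n : nat) (f : nat -> K) :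
  tableau_sum q r n.+1 f =
  tableau_sum q r n (fun u => f u.+1 + row_sum q r u f).
Proof.
rewrite /tableau_sum.
rewrite (bigID (fun T : cells n.+1 * cells n.+1 =>
                  (ord0, ord_max) \notin T.1)) /=.
under [RHS]eq_bigr => T _ do rewrite mulrDr.
rewrite big_split /=; congr (_ + _).
  rewrite (reindex_onto (fun T => (add_column T.1, add_column T.2))
    (fun T => (remove_column T.1, remove_column T.2))) /=; last first.
    by move=> [S F] /andP[tSF S0] /=; have [-> ->] := remove_columnK tSF S0.
  apply: eq_big => [[S F]|[S F] _] /=.
    by rewrite !add_columnK eqxx typeB_add_column add_column_maxr !andbT.
  by rewrite superfluous_add_column diagonal_add_column free_add_column.
rewrite (reindex_onto
  (fun TA : (cells n * cells n) * {set 'I_n.+1} =>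
     (add_row setT TA.1.1, add_row TA.2 TA.1.2))
  (fun T => ((remove_row T.1, remove_row T.2), top_row T.2))) /=; last first.
  move=> [S F] /=; rewrite negbK => /andP[tSF S0].
  by have [-> ->] := remove_rowK tSF S0.
pose U (T : cells n * cells n) := [set lift ord0 j | j in free_cols T.1 T.2].
have U0 T : ord0 \notin U T.
  by apply/imsetP => -[j _ /eqP]; rewrite (negPf (neq_lift _ _)).
have cU T : #|U T| = #|free_cols T.1 T.2| by rewrite card_imset //; exact: lift_inj.
under [RHS]eq_bigr => T _ do rewrite -cU -sum_top_rows // mulr_sumr.
rewrite pair_big_dep /=; apply: eq_big => [[[S F] A]|[[S F] A]] /=.
  by rewrite !add_rowK top_add_row eqxx add_row_top inE !andbT typeB_add_row.
rewrite typeB_add_row => /andP[/andP[/and3P[_ AS A0] _] _].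
rewrite superfluous_add_row // diagonal_add_row free_add_row // !exprD.
by rewrite [RHS]mulrA; congr (_ * _); rewrite mulrACA mulrC.
Qed.

(** Induction on n: removing the last column or the top row of the tableau
corresponds to absorbing one more letter into the words of length m. *)
Lemma tableau_sum_words (K : comNzRingType) (q r : K) (F : seq bool -> K)
    (F_headE : forall w, F (false :: w) = F w)
    (F_lastD : forall w, F (rcons w true) = r * F (rcons w false))
    (F_DE : forall w w', F (w ++ true :: false :: w') =
      q * F (w ++ false :: true :: w') + F (w ++ false :: w') + F (w ++ true :: w'))
    (m n : nat) :
  tableau_sum q r n (fun u => \sum_(w <- words m) F (w ++ nseq u false)) =
  \sum_(w <- words (n + m)) F w.
Proof.
elim: n m => [|n IHn] m.
  by rewrite tableau_sum0; apply: eq_bigr => w _; rewrite cats0.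
rewrite tableau_sumS addSnnS -IHn; apply: eq_tableau_sum => u.
by rewrite (sum_words_step F_lastD F_DE).
Qed.

Lemma typeB_gf_words (K : comNzRingType) (q r : K) (F : seq bool -> K)
    (F_nil : F [::] = 1)
    (F_headE : forall w, F (false :: w) = F w)
    (F_lastD : forall w, F (rcons w true) = r * F (rcons w false))
    (F_DE : forall w w', F (w ++ true :: false :: w') =
      q * F (w ++ false :: true :: w') + F (w ++ false :: w') + F (w ++ true :: w'))
    (n : nat) :
  typeB_gf n q r = \sum_(w <- words n) F w.
Proof.
rewrite -[in RHS](addn0 n) -(tableau_sum_words F_headE F_lastD F_DE).
apply: eq_bigr => T _; rewrite big_seq1 /=.
by rewrite word_nseqE // F_nil mulr1.
Qed.

(** * Summations and matrix words *)

Section Summations.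
Variables (K : comNzRingType) (I : eqType) (sm : summation K I).

(** A difference f - f serves here, since the null family cannot be taken from
summable_single when I is empty. *)
Lemma summable0 (f : I -> K) : summable sm f -> summable sm (fun=> 0).
Proof.
move=> sf; have := summable_lin (-1) sf sf; congr summable.
by apply: functional_extensionality => i; rewrite mulN1r addNr.
Qed.

Lemma total0 (f : I -> K) : summable sm f -> Defs.total sm (fun=> 0) = 0.
Proof.
move=> sf; rewrite -[RHS](addNr (Defs.total sm f)) -mulN1r -total_lin //.
by congr Defs.total; apply: functional_extensionality => i; rewrite mulN1r addNr.
Qed.

Lemma summableD (f g : I -> K) : summable sm f -> summable sm g ->
  summable sm (fun i => f i + g i).
Proof.
move=> sf sg; have := summable_lin 1 sf sg; congr summable.
by apply: functional_extensionality => i; rewrite mul1r.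
Qed.

Lemma totalD (f g : I -> K) : summable sm f -> summable sm g ->
  Defs.total sm (fun i => f i + g i) = Defs.total sm f + Defs.total sm g.
Proof.
move=> sf sg; rewrite -[Defs.total sm f]mul1r -total_lin //.
by congr Defs.total; apply: functional_extensionality => i; rewrite mul1r.
Qed.

Lemma totalZ (a : K) (f : I -> K) : summable sm f ->
  Defs.total sm (fun i => a * f i) = a * Defs.total sm f.
Proof.
move=> sf; have s0 := summable0 sf.
rewrite -[RHS]addr0 -(total0 sf) -total_lin //.
by congr Defs.total; apply: functional_extensionality => i; rewrite addr0.
Qed.

Lemma total_lin3 (a : K) (f g h : I -> K) :
  summable sm f -> summable sm g -> summable sm h ->
  Defs.total sm (fun i => a * f i + g i + h i) =
    a * Defs.total sm f + Defs.total sm g + Defs.total sm h.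
Proof. by move=> sf sg sh; rewrite totalD ?total_lin //; apply: summable_lin. Qed.

(** The family g only ensures that the empty sum is summable. *)
Lemma summable_sum (T : Type) (s : seq T) (f : T -> I -> K) (g : I -> K) :
  summable sm g -> (forall t, summable sm (f t)) ->
  summable sm (fun i => \sum_(t <- s) f t i).
Proof.
move=> sg sf; elim: s => [|t s IHs].
  have := summable0 sg; congr summable.
  by apply: functional_extensionality => i; rewrite big_nil.
have := summableD (sf t) IHs; congr summable.
by apply: functional_extensionality => i; rewrite big_cons.
Qed.

Lemma total_sum (T : Type) (s : seq T) (f : T -> I -> K) (g : I -> K) :
  summable sm g -> (forall t, summable sm (f t)) ->
  Defs.total sm (fun i => \sum_(t <- s) f t i) = \sum_(t <- s) Defs.total sm (f t).
Proof.
move=> sg sf; elim: s => [|t s IHs].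
  rewrite big_nil -[RHS](total0 sg); congr Defs.total.
  by apply: functional_extensionality => i; rewrite big_nil.
rewrite big_cons -IHs -totalD //; last exact: summable_sum sg _.
by congr Defs.total; apply: functional_extensionality => i; rewrite big_cons.
Qed.

Lemma mul_colvec1 (v : infvec K I) : mul_colvec sm (@infmx_one K I) v = v.
Proof.
apply: functional_extensionality => i; rewrite -[RHS](total_single sm i).
congr Defs.total; apply: functional_extensionality => k; rewrite /infmx_one eq_sym.
by case: eqP => [->|_]; rewrite ?mul1r ?mul0r.
Qed.

Lemma rowvec_mul1 (w : infvec K I) : rowvec_mul sm w (@infmx_one K I) = w.
Proof.
apply: functional_extensionality => j; rewrite -[RHS](total_single sm j).
congr Defs.total; apply: functional_extensionality => k; rewrite /infmx_one.
by case: eqP => [->|_]; rewrite ?mulr1 ?mulr0.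
Qed.

End Summations.

Section MatrixWords.
Variables (K : comNzRingType) (I : eqType) (sm : summation K I).
Variables (W V : infvec K I) (D E : infmx K I).

Definition letter (a : bool) : infmx K I := if a then D else E.

Definition word_mx (w : seq bool) : infmx K I :=
  foldr (fun a X => infmx_mul sm (letter a) X) (@infmx_one K I) w.

Definition word_vec (w : seq bool) : infvec K I := mul_colvec sm (word_mx w) V.

Hypothesis well_behaved : products_well_behaved sm W D E V.

Lemma letter_product a : product_of sm D E (letter a).
Proof. by case: a; constructor. Qed.

Lemma word_mx_product w : product_of sm D E (word_mx w).
Proof.
elim: w => [|a w IHw] /=; first exact: product_one.
exact: product_mul (letter_product a) IHw.
Qed.

Lemma letter_vec a w : mul_colvec sm (letter a) (word_vec w) = word_vec (a :: w).
Proof.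
apply: functional_extensionality => i.
exact: (mul_colvec_assoc well_behaved (letter_product a) (word_mx_product w)).
Qed.

Lemma summable_vec X w i : product_of sm D E X ->
  summable sm (fun k => X i k * word_vec w k).
Proof. by move=> pX; apply: (mul_colvec_ok well_behaved pX (word_mx_product w)). Qed.

Lemma exp_sum_words n i j :
  infmx_exp sm (infmx_add D E) n i j = \sum_(w <- words n) word_mx w i j.
Proof.
elim: n i j => [|n IHn] i j; first by rewrite big_seq1.
pose f a w k := letter a i k * word_mx w k j.
have sf a w : summable sm (f a w).
  exact: (infmx_mul_ok well_behaved (letter_product a) (word_mx_product w)).
rewrite sum_words_cons /= /infmx_mul.
transitivity (Defs.total sm (fun k => \sum_(w <- words n) (f true w k + f false w k))).
  congr Defs.total; apply: functional_extensionality => k.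
  by rewrite IHn mulr_sumr; apply: eq_bigr => w _; rewrite mulrDl.
rewrite (total_sum _ (sf true [::])) => [|w]; last exact: summableD.
by apply: eq_bigr => w _; rewrite totalD.
Qed.

(** Each word is moved from the row vector to the column vector, where it can be
read letter by letter. *)
Lemma infdot_exp_words n :
  infdot sm (rowvec_mul sm W (infmx_exp sm (infmx_add D E) n)) V =
  \sum_(w <- words n) infdot sm W (word_vec w).
Proof.
have one := product_one sm D E.
have sW w j : summable sm (fun k => W k * word_mx w k j).
  have := rowvec_mul_ok well_behaved one (word_mx_product w) j.
  by rewrite rowvec_mul1.
have sWV w : summable sm (fun k => rowvec_mul sm W (word_mx w) k * V k).
  have := infdot_ok well_behaved (word_mx_product w) one.
  by rewrite mul_colvec1.
transitivity (Defs.total sm (fun k =>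
    \sum_(w <- words n) rowvec_mul sm W (word_mx w) k * V k)).
  congr Defs.total; apply: functional_extensionality => j; rewrite -mulr_suml.
  congr (_ * _); rewrite -(total_sum _ (sW [::] j)) //.
  congr Defs.total; apply: functional_extensionality => k.
  by rewrite exp_sum_words mulr_sumr.
rewrite (total_sum _ (sWV [::])) //; apply: eq_bigr => w _.
have := infdot_assoc well_behaved one (word_mx_product w) one.
by rewrite rowvec_mul1 mul_colvec1.
Qed.

Lemma infdot_vec w : infdot_defined sm W (word_vec w).
Proof.
have := infdot_ok well_behaved (product_one sm D E) (word_mx_product w).
by rewrite rowvec_mul1.
Qed.

Lemma infdot_headE w : (forall j, rowvec_mul sm W E j = W j) ->
  infdot sm W (word_vec (false :: w)) = infdot sm W (word_vec w).
Proof.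
move=> WE; have := infdot_assoc well_behaved (product_one sm D E)
  (letter_product false) (word_mx_product w).
rewrite rowvec_mul1 -/(word_vec w) letter_vec => <-.
by congr infdot; apply: functional_extensionality.
Qed.

Lemma word_vec_lastD (r : K) :
  (forall i, mul_colvec sm D V i = r * mul_colvec sm E V i) ->
  forall w i, word_vec (rcons w true) i = r * word_vec (rcons w false) i.
Proof.
move=> DV; elim=> [|a w IHw] i /=.
  by rewrite -!letter_vec /word_vec /= mul_colvec1 DV.
rewrite -!letter_vec -totalZ; last exact/summable_vec/letter_product.
by congr Defs.total; apply: functional_extensionality => k; rewrite IHw mulrCA.
Qed.

(** Associativity isolates the factor DE in front of the remaining word w' when
w is empty; letters of w are then added on the left by linearity. *)
Lemma word_vec_DE (q : K) :
  (forall i j,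
     infmx_mul sm D E i j = q * infmx_mul sm E D i j + E i j + D i j) ->
  forall w w' i,
    word_vec (w ++ true :: false :: w') i =
      q * word_vec (w ++ false :: true :: w') i
      + word_vec (w ++ false :: w') i + word_vec (w ++ true :: w') i.
Proof.
move=> DE w w'; elim: w => [|a w IHw] i /=.
  have two a b : word_vec [:: a, b & w'] =
      mul_colvec sm (infmx_mul sm (letter a) (letter b)) (word_vec w').
    have pab := product_mul (letter_product a) (letter_product b).
    apply: functional_extensionality => k; rewrite /word_vec /=.
    rewrite (mul_colvec_assoc well_behaved pab (word_mx_product w')).
    congr Defs.total; apply: functional_extensionality => l; congr (_ * _).
    exact: (infmx_mul_assoc well_behaved (letter_product a) (letter_product b)
              (word_mx_product w')).
  rewrite !two -!letter_vec -total_lin3; try exact/summable_vec/letter_product.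
    congr Defs.total; apply: functional_extensionality => k.
    by rewrite DE !mulrDl mulrA.
  exact/summable_vec/product_mul/letter_product/letter_product.
rewrite -!letter_vec -total_lin3; try exact/summable_vec/letter_product.
congr Defs.total; apply: functional_extensionality => k.
by rewrite IHw !mulrDr mulrCA.
Qed.

End MatrixWords.

Theorem proposition3 (K : comNzRingType) (q r : K)
    (I : eqType) (sm : summation K I)
    (W V : infvec K I) (D E : infmx K I)
    (well_behaved : products_well_behaved sm W D E V)
    (WV : infdot sm W V = 1)
    (WE : forall j, rowvec_mul sm W E j = W j)
    (DV : forall i, mul_colvec sm D V i = r * mul_colvec sm E V i)
    (DE : forall i j,
       infmx_mul sm D E i j = q * infmx_mul sm E D i j + E i j + D i j)
    (n : nat) :
  typeB_gf n q r = infdot sm (rowvec_mul sm W (infmx_exp sm (infmx_add D E) n)) V.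
Proof.
rewrite (infdot_exp_words well_behaved); apply: typeB_gf_words => [|w|w|w w'].
- by rewrite /word_vec mul_colvec1.
- exact: infdot_headE.
- rewrite -totalZ; last exact: infdot_vec.
  congr Defs.total; apply: functional_extensionality => k.
  by rewrite (word_vec_lastD well_behaved DV) mulrCA.
- rewrite -total_lin3; try exact: infdot_vec.
  congr Defs.total; apply: functional_extensionality => k.
  by rewrite (word_vec_DE well_behaved DE) !mulrDr mulrCA.
Qed.
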